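(* Let $\mathbf{U} \in \mathrm{H}^{m \times \kappa}$ have orthonormal columns. Let $I \subseteq [m]$ be such that $\mathbf{R}_{\mathbf{U}} = \mathbf{U}(I,:)$ has the largest volume $\nu$ among all $|I| \times \kappa$ submatrices of $\mathbf{U}$. If $\nu(\mathbf{R}_{\mathbf{U}}) > 0$, then $$\|\mathbf{R}_{\mathbf{U}}^\dagger\|_{\ell_2(\mathrm{H}) \to \ell_2} \leq \sqrt{1 + \sum_{i \notin I} \frac{\kappa - \Delta(\tilde{\mathbf{R}}_{i})}{|I| + 1 - \kappa + \Delta(\tilde{\mathbf{R}}_{i})}}, \qquad \tilde{\mathbf{R}}_{i} = \begin{bmatrix} \mathbf{R}_{\mathbf{U}} \\ \mathbf{u}_{i}^\intercal \end{bmatrix},$$ where $\mathbf{u}_i^\intercal = \mathbf{U}(i,:)$ is the $i$th row of $\mathbf{U}$ and $\Delta$ is the inter-row rank excess.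
   Context: Let $\mathbb{F} \in \{\mathbb{R}, \mathbb{C}\}$ and let $\mathrm{H}$ be a Hilbert space over $\mathbb{F}$ with inner product linear in the second argument. A Bochner matrix $\mathbf{A} \in \mathrm{H}^{m \times n}$ is an $m \times n$ array with entries in $\mathrm{H}$. $[m] = \{1,\ldots,m\}$; $\mathbf{A}(I,:)$ is the submatrix with rows $I$. $\mathrm{H}^m$ is a Hilbert space with inner product $\sum_i \langle x_i, y_i\rangle_{\mathrm{H}}$ and norm $\|\cdot\|_{\ell_2(\mathrm{H})}$; $\mathbb{F}^n$ has the Euclidean norm. $\mathbf{A}$ is identified with the bounded operator $\mathbb{F}^n \to \mathrm{H}^m$, $x \mapsto \mathbf{A}x$, with adjoint $\mathbf{A}^*$ and Moore--Penrose pseudoinverse $\mathbf{A}^\dagger : \mathrm{H}^m \to \mathbb{F}^n$; $\mathbf{A}$ has orthonormal columns if $\mathbf{A}^*\mathbf{A} = \mathsf{I}_n$. $\|\cdot\|_{\ell_2(\mathrm{H})\to\ell_2}$ is the operator norm. The volume of $\mathbf{A}$ is $\nu(\mathbf{A}) = \sqrt{\det(\mathbf{A}^*\mathbf{A})}$. For $\mathbf{A} \in \mathrm{H}^{N \times \kappa}$ whose operator has rank $\kappa$, with rows $\mathbf{a}_i^\intercal \in \mathrm{H}^{1\times\kappa}$, let $\Gamma = \mathbf{A}^*\mathbf{A}$, $\Gamma_i = (\mathbf{a}_i^\intercal)^* \mathbf{a}_i^\intercal \in \mathbb{F}^{\kappa \times \kappa}$ (where $\mathbf{a}_i^\intercal$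 is viewed as an operator $\mathbb{F}^\kappa \to \mathrm{H}$), and $S_i = \Gamma^{-1/2}\Gamma_i\Gamma^{-1/2}$. The inter-row rank excess is $\Delta(\mathbf{A}) = \sum_{i=1}^N \Delta_i(\mathbf{A})$ with $\Delta_i(\mathbf{A}) = \det(\mathsf{I}_\kappa - S_i) - (1 - \mathrm{tr}(S_i))$. *)

(* Defs.v *)
From HB Require Import structures.
From mathcomp Require Import all_boot all_order all_algebra.
From mathcomp Require Import complex.
From mathcomp Require Import all_classical all_reals all_analysis.
From mathcomp Require Import ring.

Set Implicit Arguments.
Unset Strict Implicit.
Unset Printing Implicit Defensive.

Import Order.TTheory GRing.Theory Num.Theory.
Import numFieldNormedType.Exports.
Local Open Scope classical_set_scope.
Local Open Scope ring_scope.

Variant RorC := RealF | ComplexF.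

Definition scalar_field (R : realType) (k : RorC) : numFieldType :=
  match k with
  | RealF => R : numFieldType
  | ComplexF => R[i] : numFieldType
  end.

Definition conjF (R : realType) (k : RorC) :
    scalar_field R k -> scalar_field R k :=
  match k with
  | RealF => fun x => x
  | ComplexF => fun z : R[i] => conjc z
  end.

Definition reF (R : realType) (k : RorC) : scalar_field R k -> R :=
  match k with
  | RealF => fun x => x
  | ComplexF => fun z : R[i] => complex.Re z
  end.

Arguments conjF {R k}.
Arguments reF {R k}.

(* Conjugate-linearity in the first argument follows from inner_linearr and
   inner_conj, positive definiteness from inner_norm. *)
HB.mixin Record isHilbert (R : realType) (k : RorC) H
    & CompleteNormedModule (scalar_field R k) H := {
  inner : H -> H -> scalar_field R k ;
  inner_linearr : forall x, linear_for *%R (inner x) ;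
  inner_conj : forall x y, inner y x = conjF (inner x y) ;
  inner_norm : forall x, inner x x = `|x| ^+ 2 }.

#[short(type="hilbertType")]
HB.structure Definition Hilbert (R : realType) (k : RorC) :=
  { H of isHilbert R k H & CompleteNormedModule (scalar_field R k) H }.

Local Notation "M ^*t" := (map_mx conjF M^T) (at level 2, format "M ^*t").

Section Bochner.
Context {R : realType} {k : RorC} {H : hilbertType R k}.
Local Notation F := (scalar_field R k).

Definition dotF n (x y : 'cV[F]_n) : F := (x^*t *m y) 0 0.
Definition dotH m (x y : (H ^ m)%type) : F := \sum_i inner (x i) (y i).
Definition l2F n (x : 'cV[F]_n) : R := Num.sqrt (reF (dotF x x)).
Definition l2H m (x : (H ^ m)%type) : R := Num.sqrt (reF (dotH x x)).

(* A Bochner matrix as an operator F^n -> H^m, its adjoint (see bapp_adj), and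
   the matrix of A^* A. *)
Definition bapp m n (A : 'M[H]_(m, n)) (x : 'cV[F]_n) : (H ^ m)%type :=
  [ffun i => \sum_j x j 0 *: A i j].
Definition badj m n (A : 'M[H]_(m, n)) (y : (H ^ m)%type) : 'cV[F]_n :=
  \col_j \sum_i inner (A i j) (y i).
Definition gram m n (A : 'M[H]_(m, n)) : 'M[F]_n :=
  \matrix_(j, l) badj A (bapp A (delta_mx l 0)) j 0.

Definition orthonormal_columns m n (A : 'M[H]_(m, n)) : Prop := gram A = 1%:M.

(* A Gram matrix is positive semidefinite, so its determinant is real and reF
   loses nothing. *)
Definition volume m n (A : 'M[H]_(m, n)) : R := Num.sqrt (reF (\det (gram A))).

(* The Penrose conditions; bapp A \o X and X \o bapp A are self-adjoint for the
   inner products of H^m and F^n. *)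
Record is_mpinv m n (A : 'M[H]_(m, n)) (X : (H ^ m)%type -> 'cV[F]_n) :
    Prop := {
  mpinv_linear : linear X ;
  mpinv_AXA : forall x, bapp A (X (bapp A x)) = bapp A x ;
  mpinv_XAX : forall y, X (bapp A (X y)) = X y ;
  mpinv_AXh : forall y z, dotH (bapp A (X y)) z = dotH y (bapp A (X z)) ;
  mpinv_XAh : forall x z, dotF (X (bapp A x)) z = dotF x (X (bapp A z)) }.

(* The unique X satisfying is_mpinv A: see mpinv_unique and mpinvP. *)
Definition mpinv m n (A : 'M[H]_(m, n)) : (H ^ m)%type -> 'cV[F]_n :=
  xget (fun=> 0) (is_mpinv A).

(* Valued in \bar R, so that an unbounded operator has norm +oo. *)
Definition opnorm m n (X : (H ^ m)%type -> 'cV[F]_n) : \bar R :=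
  ereal_sup [set (l2F (X y))%:E | y in [set y : (H ^ m)%type | l2H y <= 1]].

Definition psdmx n (P : 'M[F]_n) : Prop :=
  P^*t = P /\ forall x : 'cV[F]_n, 0 <= dotF x (P *m x).
(* The unique positive semidefinite square root of a positive semidefinite P:
   see sqrtmxP and psdmx_sqr_inj. *)
Definition sqrtmx n (P : 'M[F]_n) : 'M[F]_n :=
  xget 0 [set S | psdmx S /\ S *m S = P].

(* Total in A; meaningful when gram A is invertible, i.e. when A has rank kappa.
   S is Hermitian, so its determinant and trace are real. *)
Definition excess_at n kappa (A : 'M[H]_(n, kappa)) (i : 'I_n) : R :=
  let G := invmx (sqrtmx (gram A)) in
  let S := G *m gram (row i A) *m G in
  reF (\det (1%:M - S)) - (1 - reF (\tr S)).
Definition excess n kappa (A : 'M[H]_(n, kappa)) : R := \sum_i excess_at A i.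

Definition rows m n (A : 'M[H]_(m, n)) (I : {set 'I_m}) : 'M[H]_(#|I|, n) :=
  rowsub enum_val A.
End Bochner.

Section Scalar.
Context {R : realType} {k : RorC}.
Local Notation F := (scalar_field R k).

Fact conjF_zmod_morphism : zmod_morphism (@conjF R k).
Proof. by case: k => // x y; exact: (rmorphB (@conjc R)). Qed.
Fact conjF_monoid_morphism : monoid_morphism (@conjF R k).
Proof.
by case: k => //; split;
  [exact: (rmorph1 (@conjc R))|exact: (rmorphM (@conjc R))].
Qed.
HB.instance Definition _ :=
  GRing.isZmodMorphism.Build F F conjF conjF_zmod_morphism.
HB.instance Definition _ :=
  GRing.isMonoidMorphism.Build F F conjF conjF_monoid_morphism.

Lemma conjFK : involutive (@conjF R k).
Proof. by case: k => // x; exact: conjcK. Qed.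
Lemma mulJ_norm (x : F) : conjF x * x = `|x| ^+ 2.
Proof.
move: x; case: k => x; first by rewrite [RHS]real_normK ?num_real.
by have /= -> := sqr_normc x; rewrite mulrC.
Qed.
Lemma conjF_ge0 (x : F) : 0 <= x -> conjF x = x.
Proof.
move: x; case: k => // x /(@ger0_Im _ _).
by case: x => a b /= ->; rewrite oppr0.
Qed.
End Scalar.

Section DotF.
Context {R : realType} {k : RorC}.
Local Notation F := (scalar_field R k).

Lemma trmxJK m n (M : 'M[F]_(m, n)) : (M^*t)^*t = M.
Proof. by apply/matrixP => i j; rewrite !mxE conjFK. Qed.
Lemma trmxJM m n p (M : 'M[F]_(m, n)) (N : 'M[F]_(n, p)) :
  (M *m N)^*t = N^*t *m M^*t.
Proof. by rewrite trmx_mul map_mxM. Qed.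

Lemma dotFE n (x : 'cV[F]_n) : dotF x x = \sum_i `|x i 0| ^+ 2.
Proof. by rewrite /dotF mxE; apply: eq_bigr => i _; rewrite !mxE mulJ_norm. Qed.
Lemma dotF_ge0 n (x : 'cV[F]_n) : 0 <= dotF x x.
Proof. by rewrite dotFE sumr_ge0 // => i _; rewrite exprn_ge0. Qed.
Lemma dotF_eq0 n (x : 'cV[F]_n) : dotF x x = 0 -> x = 0.
Proof.
rewrite dotFE => /eqP; rewrite psumr_eq0 => [/allP x0|i _];
  last exact: exprn_ge0.
apply/colP => i; rewrite mxE; apply/eqP.
by have := x0 i (mem_index_enum _); rewrite sqrf_eq0 normr_eq0.
Qed.
Lemma dotF_adj m n (M : 'M[F]_(m, n)) x y :
  dotF (M *m x) y = dotF x (M^*t *m y).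
Proof. by rewrite /dotF trmxJM mulmxA. Qed.
Lemma dotFDr n (x y z : 'cV[F]_n) : dotF x (y + z) = dotF x y + dotF x z.
Proof. by rewrite /dotF mulmxDr !mxE. Qed.
Lemma dotFZr n a (x y : 'cV[F]_n) : dotF x (a *: y) = a * dotF x y.
Proof. by rewrite /dotF -scalemxAr mxE. Qed.
Lemma dotFB n (x y z : 'cV[F]_n) : dotF (x - y) z = dotF x z - dotF y z.
Proof. by rewrite /dotF linearB /= map_mxB /= mulmxBl !mxE. Qed.
Lemma dotFC n (x y : 'cV[F]_n) : dotF y x = conjF (dotF x y).
Proof.
rewrite /dotF !mxE rmorph_sum /=; apply: eq_bigr => i _.
by rewrite !mxE rmorphM /= conjFK mulrC.
Qed.

Lemma dotFDl n (x y z : 'cV[F]_n) : dotF (x + y) z = dotF x z + dotF y z.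
Proof. by rewrite dotFC dotFDr rmorphD /= -!dotFC. Qed.
Lemma dotFZl n a (x y : 'cV[F]_n) : dotF (a *: x) y = conjF a * dotF x y.
Proof. by rewrite dotFC dotFZr rmorphM /= -dotFC. Qed.
Lemma dotFJ n (x y : 'cV[F]_n) :
  dotF (map_mx conjF x) (map_mx conjF y) = conjF (dotF x y).
Proof. by rewrite /dotF map_trmx -map_mxM mxE. Qed.

Section DotH.
Context {H : hilbertType R k}.

Lemma innerDr (x y z : H) : inner x (y + z) = inner x y + inner x z.
Proof. by have := inner_linearr x 1 y z; rewrite scale1r mul1r. Qed.
Lemma inner0r (x : H) : inner x 0 = 0.
Proof. by apply: (addrI (inner x 0)); rewrite -innerDr !addr0. Qed.
Lemma innerZr a (x y : H) : inner x (a *: y) = a * inner x y.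
Proof. by have := inner_linearr x a y 0; rewrite addr0 inner0r addr0. Qed.
Lemma innerDl (x y z : H) : inner (y + z) x = inner y x + inner z x.
Proof. by rewrite inner_conj innerDr rmorphD /= -!inner_conj. Qed.
Lemma inner0l (x : H) : inner 0 x = 0.
Proof. by rewrite inner_conj inner0r rmorph0. Qed.
Lemma innerZl a (x y : H) : inner (a *: y) x = conjF a * inner y x.
Proof. by rewrite inner_conj innerZr rmorphM /= -inner_conj. Qed.
Lemma inner_sumr (x : H) n (y : 'I_n -> H) :
  inner x (\sum_i y i) = \sum_i inner x (y i).
Proof.
elim/big_ind2 : _ => //; first exact: inner0r.
by move=> a b c d <- <-; rewrite innerDr.
Qed.
Lemma inner_suml (x : H) n (y : 'I_n -> H) :
  inner (\sum_i y i) x = \sum_i inner (y i) x.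
Proof.
by rewrite inner_conj inner_sumr rmorph_sum /=;
  under eq_bigr do rewrite -inner_conj.
Qed.

Lemma dotHB m (x y z : (H ^ m)%type) : dotH (x - y) z = dotH x z - dotH y z.
Proof.
rewrite /dotH -sumrB; apply: eq_bigr => i _; rewrite !ffunE innerDl.
by rewrite -scaleN1r innerZl rmorphN1 mulN1r.
Qed.
Lemma dotHC m (x y : (H ^ m)%type) : dotH y x = conjF (dotH x y).
Proof.
by rewrite /dotH rmorph_sum; apply: eq_bigr => i _; rewrite inner_conj.
Qed.
Lemma dotH_eq0 m (x : (H ^ m)%type) : dotH x x = 0 -> x = 0.
Proof.
rewrite /dotH; under eq_bigr do rewrite inner_norm.
move/eqP; rewrite psumr_eq0 => [/allP x0|i _];
  last exact: exprn_ge0.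
apply/ffunP => i; rewrite ffunE; apply/eqP.
by have := x0 i (mem_index_enum _); rewrite sqrf_eq0 normr_eq0.
Qed.

Section Adj.
Context {m n : nat} (A : 'M[H]_(m, n)).

Lemma bapp_adj x y : dotH (bapp A x) y = dotF x (badj A y).
Proof.
rewrite /dotF mxE /dotH; under eq_bigr => i _.
  rewrite ffunE inner_suml; under eq_bigr do rewrite innerZl; over.
rewrite exchange_big; apply: eq_bigr => j _; rewrite !mxE mulr_sumr.
by apply: eq_bigr.
Qed.

Lemma gramE j l : gram A j l = \sum_i inner (A i j) (A i l).
Proof.
rewrite !mxE; apply: eq_bigr => i _; rewrite ffunE; congr inner.
rewrite (bigD1 l) //= mxE !eqxx scale1r big1 ?addr0 // => p pl.
by rewrite mxE (negPf pl) scale0r.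
Qed.

Lemma badj_bapp x : badj A (bapp A x) = gram A *m x.
Proof.
apply/colP => j; rewrite !mxE; under eq_bigr => i _.
  rewrite ffunE inner_sumr; under eq_bigr do rewrite innerZr; over.
rewrite exchange_big; apply: eq_bigr => l _.
by rewrite gramE mulr_suml; apply: eq_bigr => i _; rewrite mulrC.
Qed.

Lemma gram_herm : (gram A)^*t = gram A.
Proof.
apply/matrixP => j l; rewrite [LHS]mxE [X in conjF X]mxE !gramE rmorph_sum /=.
by apply: eq_bigr => i _; rewrite -inner_conj.
Qed.

Lemma bapp_linear : linear (bapp A).
Proof.
move=> a x y; apply/ffunP => i; rewrite !ffunE scaler_sumr -big_split.
by apply: eq_bigr => j _; rewrite !mxE scalerDl scalerA.
Qed.
Lemma badj_linear : linear (badj A).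
Proof.
move=> a x y; apply/colP => j; rewrite !mxE mulr_sumr -big_split.
by apply: eq_bigr => i _; rewrite !ffunE innerDr innerZr.
Qed.

Lemma bappB x y : bapp A (x - y) = bapp A x - bapp A y.
Proof. by rewrite addrC -scaleN1r bapp_linear scaleN1r addrC. Qed.

Lemma bapp_eq0 x : dotF x (gram A *m x) = 0 -> bapp A x = 0.
Proof. by rewrite -badj_bapp -bapp_adj; exact: dotH_eq0. Qed.

Lemma mpinv_unique X Y : is_mpinv A X -> is_mpinv A Y -> X = Y.
Proof.
have dotHI (x y : (H ^ m)%type) : (forall z, dotH x z = dotH y z) -> x = y.
  by move=> xy; apply/eqP; rewrite -subr_eq0; apply/eqP/dotH_eq0;
    rewrite dotHB xy subrr.
have dotFI (x y : 'cV[F]_n) : (forall z, dotF x z = dotF y z) -> x = y.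
  by move=> xy; apply/eqP; rewrite -subr_eq0; apply/eqP/dotF_eq0;
    rewrite dotFB xy subrr.
move=> [_ X1 X2 X3 X4] [_ Y1 Y2 Y3 Y4]; apply/funext => y.
have AXY : bapp A (X y) = bapp A (Y y).
  by apply: dotHI => z; rewrite -[bapp A (X y)]Y1 Y3 X3 X1 -Y3.
rewrite -[LHS]X2 AXY; apply: dotFI => z.
by rewrite -[Y y]Y2 X4 Y4 X1 -Y4.
Qed.

Lemma mpinv_exists : exists X, is_mpinv A X.
Proof.
set G := gram A; set C := row_base G; set D := col_base G.
have DC : D *m C = G by exact: mulmx_base.
have Cf : row_free C by exact: row_base_free.
have Df : row_free D^T by rewrite /row_free mxrank_tr; exact: col_base_full.
clearbody C D; move: (\rank G) C D DC Cf Df => r C D DC Cf Df.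
have Gh : G^*t = G by exact: gram_herm.
have unitP p (M : 'M[F]_p) :
    (forall v : 'cV_p, M^*t *m v = 0 -> v = 0) -> M \in unitmx.
  move=> Minj; rewrite -row_free_unit -kermx_eq0; apply/eqP/row_matrixP => i.
  rewrite row0; have := Minj (row i (kermx M))^*t.
  rewrite -trmxJM -row_mul mulmx_ker row0 trmx0 map_mx0 => /(_ erefl) r0.
  by rewrite -[LHS]trmxJK r0 trmx0 map_mx0.
have CJI (v : 'cV_r) : C^*t *m v = 0 -> v = 0.
  move=> v0; rewrite -[v]trmxJK; suff -> : v^*t = 0 by rewrite trmx0 map_mx0.
  apply: (row_free_inj Cf); rewrite /= mul0mx -[LHS]trmxJK trmxJM trmxJK v0.
  by rewrite trmx0 map_mx0.
have CCu : C *m C^*t \in unitmx.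
  apply: unitP => v; rewrite trmxJM trmxJK -mulmxA => v0; apply/CJI/dotF_eq0.
  by rewrite dotF_adj trmxJK v0 /dotF mulmx0 mxE.
have DI (v : 'cV_r) : D *m v = 0 -> v = 0.
  move=> v0; apply: trmx_inj; apply: (row_free_inj Df).
  by rewrite /= -!trmx_mul v0 mulmx0.
set E := C *m G *m C^*t.
have Eh : E^*t = E by rewrite /E !trmxJM trmxJK Gh mulmxA.
have Eu : E \in unitmx.
  apply: unitP => v; rewrite Eh => v0.
  have AC0 : bapp A (C^*t *m v) = 0.
    by apply: bapp_eq0; rewrite -/G dotF_adj trmxJK !mulmxA -/E v0 /dotF
      mulmx0 mxE.
  have : D *m (C *m C^*t *m v) = 0.
    by rewrite !mulmxA DC -mulmxA -badj_bapp AC0; apply/colP => j;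
      rewrite !mxE big1 // => i _; rewrite ffunE inner0r.
  by move/DI/(congr1 (mulmx (invmx (C *m C^*t)))); rewrite mulKmx // mulmx0.
set W := C^*t *m invmx E *m C.
have invJ p (M : 'M[F]_p) : (invmx M)^*t = invmx M^*t.
  by rewrite trmx_inv map_invmx.
have Wh : W^*t = W by rewrite /W !trmxJM trmxJK invJ Eh mulmxA.
set P := C^*t *m invmx (C *m C^*t) *m C.
have Ph : P^*t = P by rewrite /P !trmxJM trmxJK invJ trmxJM trmxJK mulmxA.
have WG : W *m G = P.
  rewrite /W /P -!mulmxA; congr (_ *m _).
  apply: (can_inj (mulKmx Eu)); rewrite mulKVmx //.
  by rewrite /E -DC !mulmxA -(mulmxA (C *m D) C) mulmxK.
have GW : G *m W = P by rewrite -Gh -Wh -trmxJM WG.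
have GP : G *m P = G by rewrite -{1}DC /P -!mulmxA !(mulmxA C) mulKVmx.
have WP : P *m W = W.
  by rewrite /P /W -!mulmxA (mulmxA C) mulKmx.
clearbody W P; exists (fun y => W *m badj A y).
have bK x : G *m x = 0 -> bapp A x = 0.
  by move=> x0; apply: bapp_eq0; rewrite -/G x0 /dotF mulmx0 mxE.
split.
- by move=> a x y; rewrite badj_linear mulmxDr -scalemxAr.
- move=> x; rewrite badj_bapp -/G mulmxA WG; apply/eqP.
  by rewrite -subr_eq0 -bappB; apply/eqP/bK; rewrite mulmxBr mulmxA GP subrr.
- by move=> y; rewrite badj_bapp -/G !mulmxA WG WP.
- move=> y z; by rewrite bapp_adj dotF_adj Wh [RHS]dotHC bapp_adj -dotFC.
- by move=> x z; rewrite !badj_bapp -/G !mulmxA WG dotF_adj Ph.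
Qed.

Lemma mpinvP : is_mpinv A (mpinv A).
Proof. exact: xgetPex mpinv_exists. Qed.

End Adj.
End DotH.
End DotF.

Section Psd.
Context {R : realType} {k : RorC}.
Local Notation F := (scalar_field R k).

Lemma psdmx_ker n (S : 'M[F]_n) x :
  psdmx S -> dotF x (S *m x) = 0 -> S *m x = 0.
Proof.
move=> [Sh S0] xS; apply: dotF_eq0; apply/eqP; apply: contraT => c0.
set u := S *m x.
have {}c0 : 0 < dotF u u by rewrite lt_def c0 dotF_ge0.
have d0 := S0 u; set c := dotF u u in c0 *; set d := dotF u _ in d0.
have d1 : 0 < d + 1 by rewrite ltr_wpDl.
pose t := c / (d + 1); have t0 : 0 < t by rewrite divr_gt0.
have tc : t * d < c.
  by rewrite /t mulrAC ltr_pdivrMr // ltr_pM2l // ltrDl.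
have := S0 (x - t *: u).
suff -> : dotF (x - t *: u) (S *m (x - t *: u)) = t * (t * d - c - c).
  by rewrite pmulr_rge0 // lt_geF // subr_lt0 (lt_trans _ c0) // subr_lt0.
have tJ : conjF t = t by apply: conjF_ge0; exact: ltW.
have xu : dotF x (S *m u) = c by rewrite -{1}Sh -dotF_adj.
clearbody t; rewrite mulmxBr -scalemxAr -!scaleNr.
rewrite dotFDl !dotFDr !dotFZl !dotFZr rmorphN /=.
rewrite tJ -/u xS xu -/c -/d.
ring.
Qed.

Lemma mxtrace_psd n (S D : 'M[F]_n) :
  \tr (D^*t *m S *m D) = \sum_j dotF (col j D) (S *m col j D).
Proof.
apply: eq_bigr => j _; rewrite /dotF tr_col map_row mulmxA -row_mul !mxE.
by apply: eq_bigr => i _; rewrite !mxE.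
Qed.

Lemma psdmx_sqr_inj n (S T : 'M[F]_n) :
  psdmx S -> psdmx T -> S *m S = T *m T -> S = T.
Proof.
move=> Sp Tp ST; pose D := S - T.
have Dh : D^*t = D by rewrite /D linearB /= map_mxB /= Sp.1 Tp.1.
have anti : (S + T) *m D = - (D *m (S + T)).
  by apply/eqP; rewrite -addr_eq0 /D mulmxDl mulmxBl !mulmxDr !mulmxN ST;
    move: (S *m T) (T *m S) (T *m T) => X Y Z; apply/eqP/matrixP => i j;
    rewrite !mxE; ring.
have tr0 : \tr (D^*t *m S *m D) + \tr (D^*t *m T *m D) = 0.
  rewrite -mxtraceD -mulmxDl -mulmxDr Dh; set x := \tr _.
  have : x = - x.
    by rewrite /x -{1}mulmxA anti mulmxN mulmxA raddfN /= mxtrace_mulC mulmxA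
      mxtrace_mulC mulmxA.
  by move/eqP; rewrite -addr_eq0 -mulr2n mulrn_eq0 /= => /eqP.
have ge0 (Q : 'M[F]_n) : psdmx Q -> 0 <= \tr (D^*t *m Q *m D).
  by move=> [_ Q0]; rewrite mxtrace_psd sumr_ge0.
have eq0 (Q : 'M[F]_n) : psdmx Q -> \tr (D^*t *m Q *m D) = 0 -> Q *m D = 0.
  move=> Qp /eqP; rewrite mxtrace_psd psumr_eq0 => [/allP Q0|j _];
    last exact: Qp.2.
  apply: trmx_inj; apply/row_matrixP => j; rewrite trmx0 row0 -tr_col.
  rewrite colE -mulmxA -colE.
  rewrite psdmx_ker ?trmx0 //; apply/eqP/Q0; exact: mem_index_enum.
have /eqP := tr0; rewrite paddr_eq0 ?ge0 // => /andP[/eqP/eq0 SD /eqP/eq0 TD].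
apply/eqP; rewrite -subr_eq0 -/D; apply/eqP.
have DD : D^*t *m D = 0 by rewrite Dh {1}/D mulmxBl SD // TD // subrr.
apply: trmx_inj; apply/row_matrixP => j; rewrite trmx0 row0 -tr_col.
rewrite (_ : col j D = 0) ?trmx0 //; apply: dotF_eq0.
by rewrite /dotF tr_col map_row -row_mul colE mulmxA DD mul0mx row0 mxE.
Qed.

Lemma psdmx_conj m n (S : 'M[F]_m) (B : 'M[F]_(m, n)) :
  psdmx S -> psdmx (B^*t *m S *m B).
Proof.
move=> [Sh S0]; split; first by rewrite !trmxJM trmxJK Sh mulmxA.
by move=> x; rewrite -!mulmxA -{1}[B]trmxJK -dotF_adj trmxJK.
Qed.

Lemma psdmx_diag n (d : 'rV[F]_n) : (forall j, 0 <= d 0 j) -> psdmx (diag_mx d).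
Proof.
move=> d0; split=> [|x].
  rewrite tr_diag_mx map_diag_mx; congr diag_mx.
  by apply/rowP => j; rewrite mxE; exact: conjF_ge0.
rewrite /dotF mul_diag_mx mxE sumr_ge0 // => i _.
by rewrite !mxE mulrCA mulr_ge0 // mulJ_norm exprn_ge0.
Qed.

Lemma psdmx_gram (H : hilbertType R k) m n (A : 'M[H]_(m, n)) : psdmx (gram A).
Proof.
split=> [|x]; first exact: gram_herm.
rewrite -badj_bapp -bapp_adj sumr_ge0 // => i _.
by rewrite inner_norm exprn_ge0.
Qed.
End Psd.

Lemma psdmx_sqrt_complex (R : realType) n (P : 'M[scalar_field R ComplexF]_n) :
  psdmx P -> exists S, psdmx S /\ S *m S = P.
Proof.
move=> [Ph P0]; pose C : numClosedFieldType := R[i].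
have conjE m p (M : 'M[scalar_field R ComplexF]_(m, p)) :
    map_mx (@Num.conj C) (M^T : 'M[C]_(p, m)) = M^*t.
  by [].
have [V [d [VV PE]]] : exists (V : 'M[scalar_field R ComplexF]_n)
    (d : 'rV[scalar_field R ComplexF]_n),
    V *m V^*t = 1%:M /\ P = V^*t *m diag_mx d *m V.
  pose Q : 'M[C]_n := P.
  have Qh : Q \is hermsymmx 
    by apply/is_hermitianmxP; rewrite expr0 scale1r conjE.
  have Vu := spectral_unitarymx Q.
  exists (spectralmx Q), (spectral_diag Q); split.
    by rewrite -conjE; apply/unitarymxP.
  by have /orthomx_spectralP := hermitian_normalmx Qh;
    rewrite (invmx_unitary Vu) conjE.
have dE : diag_mx d = (V^*t)^*t *m P *m V^*t.
  by rewrite trmxJK [P]PE -!mulmxA VV mulmx1 mulmxA VV mul1mx.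
have d0 j : 0 <= d 0 j.
  have := (psdmx_conj V^*t (conj Ph P0)).2 (delta_mx j 0).
  rewrite -dE /dotF mul_diag_mx mxE (bigD1 j) //= big1 => [|i ij].
    by rewrite !mxE !eqxx rmorph1 mul1r mulr1 addr0.
  by rewrite !mxE (negPf ij) mulr0 mulr0.
pose e : 'rV[scalar_field R ComplexF]_n :=
  map_mx (fun z : C => sqrtC z) (d : 'rV[C]_n).
exists (V^*t *m diag_mx e *m V); split.
  by apply: psdmx_conj; apply: psdmx_diag => j; rewrite mxE sqrtC_ge0.
rewrite [RHS]PE !mulmxA -(mulmxA (_ *m diag_mx e) V) VV mulmx1.
rewrite -(mulmxA V^*t) mulmx_diag; congr (_ *m diag_mx _ *m _).
by apply/rowP => j; rewrite !mxE -expr2 sqrtCK.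
Qed.

Lemma psdmx_sqrt_real (R : realType) n (P : 'M[scalar_field R RealF]_n) :
  psdmx P -> exists S, psdmx S /\ S *m S = P.
Proof.
move=> [Ph P0].
pose iC : scalar_field R ComplexF := (0 +i* 1)%C.
pose c : R -> R[i] := real_complex R.
pose cx m p (M : 'M[scalar_field R RealF]_(m, p)) :
    'M[scalar_field R ComplexF]_(m, p) :=
  map_mx c (M : 'M[R]_(m, p)).
have cxM m p q (M : 'M[scalar_field R RealF]_(m, p))
    (N : 'M[scalar_field R RealF]_(p, q)) :
  cx _ _ (M *m N) = cx _ _ M *m cx _ _ N by exact: map_mxM.
have cxD m p (M N : 'M[scalar_field R RealF]_(m, p)) :
    cx _ _ (M + N) = cx _ _ M + cx _ _ N.
  exact: map_mxD.
have cxJ m p (M : 'M[scalar_field R RealF]_(m, p)) :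
    (cx _ _ M)^*t = cx _ _ M^*t.
  by apply/matrixP => i j; rewrite !mxE; exact: conjc_real.
have cxI m p : injective (cx m p).
  by move=> M N /matrixP MN; apply/matrixP => i j; have := MN i j;
    rewrite !mxE => -[].
have cdot m (x y : 'cV[scalar_field R RealF]_m) :
    dotF (cx _ _ x) (cx _ _ y) = c (dotF x y).
  by rewrite /dotF cxJ -cxM mxE.
have ReIm (x : 'cV[scalar_field R ComplexF]_n) : exists a b,
    x = cx _ _ a + iC *: cx _ _ b.
  exists (map_mx (@complex.Re R) (x : 'cV[R[i]]_n)),
    (map_mx (@complex.Im R) (x : 'cV[R[i]]_n)).
  by apply/matrixP => i j; rewrite !mxE; exact: complexE.
have cxpsd : psdmx (cx _ _ P).
  split=> [|x]; first by rewrite cxJ Ph.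
  have [a [b ->]] := ReIm x.
  have ab : dotF a (P *m b) = dotF b (P *m a).
    by rewrite -{1}Ph -dotF_adj dotFC.
  suff -> : dotF (cx _ _ a + iC *: cx _ _ b)
      (cx _ _ P *m (cx _ _ a + iC *: cx _ _ b)) =
      c (dotF a (P *m a) + dotF b (P *m b)).
    by rewrite [leRHS]/c ler0c addr_ge0 ?P0.
  rewrite mulmxDr -scalemxAr -!cxM dotFDl !dotFDr !dotFZl !dotFZr !cdot ab.
  have -> : conjF iC = - iC.
    by apply/eqP; rewrite (@eq_complex R) /= oppr0 !eqxx.
  have i2 : iC * iC = -1 by rewrite -expr2; exact: sqr_i.
  by rewrite (mulrA (- iC)) !mulNr i2 mulN1r opprK addrA addrK /c rmorphD.
have [T [Tp TT]] := psdmx_sqrt_complex cxpsd.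
have TJ : map_mx conjF T = T.
  apply: psdmx_sqr_inj => //; last first.
    rewrite -map_mxM TT; apply/matrixP => i j; rewrite !mxE; exact: conjc_real.
  split=> [|x]; first by rewrite map_trmx Tp.1.
  have -> : x = map_mx conjF (map_mx conjF x).
    by rewrite -map_mx_comp map_mx_id //; exact: conjFK.
  by rewrite -map_mxM dotFJ conjF_ge0 Tp.2.
pose S : 'M[scalar_field R RealF]_n :=
  map_mx (@complex.Re R) (T : 'M[R[i]]_n).
have TE : T = cx _ _ S.
  apply/matrixP => i j; rewrite !mxE; have /matrixP/(_ i j) := TJ; rewrite !mxE.
  case: (T i j) => a b /= [] /eqP; rewrite -subr_eq0 -opprD oppr_eq0 -mulr2n.
  by rewrite mulrn_eq0 /= => /eqP ->.
exists S; split; last by apply: cxI; rewrite cxM -TE.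
split=> [|x]; first by apply: cxI; rewrite -cxJ -TE Tp.1.
by have := Tp.2 (cx _ _ x); rewrite TE -cxM cdot [leRHS]/c ler0c.
Qed.

Lemma sqrtmxP (R : realType) (k : RorC) n (P : 'M[scalar_field R k]_n) :
  psdmx P -> psdmx (sqrtmx P) /\ sqrtmx P *m sqrtmx P = P.
Proof.
move=> Pp; apply: (@xgetPex _ 0 [set S | psdmx S /\ S *m S = P]).
by move: P Pp; case: k => P Pp;
  [exact: psdmx_sqrt_real|exact: psdmx_sqrt_complex].
Qed.

(* Main.v *)
(** Let G be the Gram matrix of R_U, let G_i be that of row i of U, and put
    t_i = tr (G^(-1/2) G_i G^(-1/2)).  Since U has orthonormal columns,
    1 = G + sum_(i notin I) G_i, so that
    |x|^2 <= (1 + sum_(i notin I) t_i) <x, G x>, while <x, G x> <= |y|^2 for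
    x = R_U^+ y because R_U R_U^+ is an orthogonal projection.  It remains to
    bound t_i.  The matrices S_j of [R_U; u_i] add up to the identity and
    det (1 - S_j) is the ratio of the squared volumes of [R_U; u_i] without its
    row j and of [R_U; u_i].  Hence, with N = |I| + 1, the sum
    D = N - kappa + Delta of these ratios is at most N det G / det (G + G_i) by
    maximality of the volume of R_U.  As det (G + G_i) / det G >= 1 + t_i, this
    gives 1 + t_i <= N / D, i.e. t_i <= (kappa - Delta) / (N - kappa + Delta). *)
From HB Require Import structures.
Require Import Defs.
From mathcomp Require Import all_boot all_order all_algebra.
From mathcomp Require Import complex.
From mathcomp Require Import all_classical all_reals all_analysis.
From mathcomp Require Import ring.

Set Implicit Arguments.
Unset Strict Implicit.
Unset Printing Implicit Defensive.

Import Order.TTheory GRing.Theory Num.Theory.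
Local Open Scope ring_scope.

Local Notation "M ^*t" := (map_mx conjF M^T) (at level 2, format "M ^*t").

(** * Real parts of scalars *)

Section RealPart.
Context {R : realType} {k : RorC}.
Local Notation F := (scalar_field R k).

Fact reF_zmod_morphism : zmod_morphism (@reF R k).
Proof. by case: k => // x y; exact: (raddfB (@complex.Re R)). Qed.
HB.instance Definition _ :=
  GRing.isZmodMorphism.Build F R reF reF_zmod_morphism.

Lemma reF_nat n : reF (n%:R : F) = n%:R.
Proof. by case: k => //; exact: (raddfMn (@complex.Re R)). Qed.

Lemma reF_le (x y : F) : x <= y -> reF x <= reF y.
Proof. by move: x y; case: k => // x y; rewrite lecE => /andP[]. Qed.

(** A nonnegative scalar has no imaginary part, so the product of imaginary parts drops out. *)
Lemma reFM (x y : F) : 0 <= x -> reF (x * y) = reF x * reF y.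
Proof.
move: x y; case: k => // x y; rewrite lecE => /andP[].
by case: x y => [a b] [c d] /= /eqP -> _; rewrite mul0r subr0.
Qed.

Lemma reF_ge0 (x : F) : 0 <= x -> 0 <= reF x.
Proof. by move/reF_le; rewrite raddf0. Qed.

Lemma reF_neq0 (x : F) : 0 < reF x -> x != 0.
Proof. by apply: contraTneq => ->; rewrite raddf0 ltxx. Qed.

End RealPart.

(** * Trace and determinant inequalities for positive semidefinite matrices *)

Section PsdInequalities.
Context {R : realType}.

Lemma mxtrace_psd_ge0 k n (P : 'M[scalar_field R k]_n) : psdmx P -> 0 <= \tr P.
Proof.
move=> [_ P0]; have := mxtrace_psd P 1%:M.
by rewrite trmx1 map_mx1 mul1mx mulmx1 => ->; rewrite sumr_ge0.
Qed.

Lemma psdmx_factor k n (P : 'M[scalar_field R k]_n) :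
  psdmx P -> exists2 S, psdmx S & P = S^*t *m S.
Proof. by move=> /sqrtmxP[Sp <-]; exists (sqrtmx P) => //; rewrite Sp.1. Qed.

Lemma psdmx_mulJ k m n (S : 'M[scalar_field R k]_(m, n)) : psdmx (S^*t *m S).
Proof.
split=> [|x]; first by rewrite trmxJM trmxJK.
by rewrite -mulmxA -dotF_adj dotF_ge0.
Qed.

Lemma det_psd_ge0 k n (P : 'M[scalar_field R k]_n) : psdmx P -> 0 <= \det P.
Proof.
move=> /psdmx_factor[S _ ->].
by rewrite det_mulmx det_map_mx det_tr mulJ_norm exprn_ge0.
Qed.

Lemma prod_1D_ge (F : numFieldType) n (d : 'I_n -> F) :
  (forall i, 0 <= d i) -> 1 + \sum_i d i <= \prod_i (1 + d i).
Proof.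
move=> d0.
(* Nonnegativity of the partial sums is carried through the induction: multiplying two partial
   bounds needs it. *)
suff [] : 0 <= \sum_i d i /\ 1 + \sum_i d i <= \prod_i (1 + d i) by [].
elim/big_ind2 : _ => [||i _]; first by rewrite addr0.
  move=> s p t q [s0 sp] [t0 tq]; split; first exact: addr_ge0.
  apply: le_trans (ler_pM _ _ sp tq); rewrite ?addr_ge0 //.
  rewrite mulrDl !mulrDr !mul1r mulr1 -!addrA lerD2l addrCA lerD2l lerDl.
  exact: mulr_ge0.
by split.
Qed.

(** The spectral theorem for Hermitian matrices; the eigenvalue [d 0 j] is the quadratic form of [P]
    at V^* e_j, hence nonnegative. *)
Lemma psdmx_spectral n (P : 'M[scalar_field R ComplexF]_n) : psdmx P ->
  exists (V : 'M[scalar_field R ComplexF]_n) d,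
    [/\ V *m V^*t = 1%:M, P = V^*t *m diag_mx d *m V & forall j, 0 <= d 0 j].
Proof.
move=> Pp; pose C : numClosedFieldType := R[i].
have conjE m p (M : 'M[scalar_field R ComplexF]_(m, p)) :
    map_mx (@Num.conj C) (M^T : 'M[C]_(p, m)) = M^*t.
  by [].
have [V [d [VV PE]]] : exists (V : 'M[scalar_field R ComplexF]_n)
    (d : 'rV[scalar_field R ComplexF]_n),
    V *m V^*t = 1%:M /\ P = V^*t *m diag_mx d *m V.
  have Ph : (P : 'M[C]_n) \is hermsymmx.
    by apply/is_hermitianmxP; rewrite expr0 scale1r conjE Pp.1.
  have Vu := spectral_unitarymx (P : 'M[C]_n).
  exists (spectralmx (P : 'M[C]_n)), (spectral_diag (P : 'M[C]_n)); split.
    by rewrite -conjE; apply/unitarymxP.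
  by have /orthomx_spectralP := hermitian_normalmx Ph;
    rewrite (invmx_unitary Vu) conjE.
exists V, d; split=> // j.
have dE : diag_mx d = (V^*t)^*t *m P *m V^*t.
  by rewrite trmxJK [P]PE -!mulmxA VV mulmx1 mulmxA VV mul1mx.
have := (psdmx_conj V^*t Pp).2 (delta_mx j 0).
rewrite -dE /dotF mul_diag_mx mxE (bigD1 j) //= big1 => [|i ij].
  by rewrite !mxE !eqxx rmorph1 mul1r mulr1 addr0.
by rewrite !mxE (negPf ij) mulr0 mulr0.
Qed.

(** In an eigenbasis the two sides are 1 + sum d_j and prod (1 + d_j). *)
Lemma det_1D_psd_complex n (P : 'M[scalar_field R ComplexF]_n) :
  psdmx P -> 1 + \tr P <= \det (1%:M + P).
Proof.
move=> /psdmx_spectral[V [d [VV -> d0]]].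
have V'V : V^*t *m V = 1%:M by exact: mulmx1C.
rewrite mxtrace_mulC mulmxA VV mul1mx mxtrace_diag.
have -> : 1%:M + V^*t *m diag_mx d *m V = V^*t *m (1%:M + diag_mx d) *m V.
  by rewrite mulmxDr mulmxDl mulmx1 V'V.
rewrite !det_mulmx mulrAC -det_mulmx V'V det1 mul1r.
have -> : 1%:M + diag_mx d = diag_mx (\row_j (1 + d 0 j)).
  by apply/matrixP => i j; rewrite !mxE -mulrnDl.
rewrite det_diag; under eq_bigr do rewrite mxE.
exact: prod_1D_ge.
Qed.

Lemma det_1D_psd k n (P : 'M[scalar_field R k]_n) :
  psdmx P -> 1 + \tr P <= \det (1%:M + P).
Proof.
move: P; case: k => P; last exact: det_1D_psd_complex.
(* The real case is complexified. The factorization P = S^* S survives the embedding, which makes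
   the complex matrix positive semidefinite at once. *)
move=> /psdmx_factor[S _ PE].
pose c := real_complex R.
pose T : 'M[scalar_field R ComplexF]_n := map_mx c (S : 'M[R]_n).
have cP : map_mx c (P : 'M[R]_n) = T^*t *m T.
  rewrite PE map_mxM; congr (_ *m _).
  by apply/matrixP => i j; rewrite !mxE; exact/esym/conjc_real.
have := det_1D_psd_complex (psdmx_mulJ T).
rewrite -cP -[X in X + _ <= _](rmorph1 c) -[1%:M](map_mx1 c).
by rewrite -map_mxD det_map_mx trace_map_mx -rmorphD lecR.
Qed.

Lemma dotF_CS k n (x y : 'cV[scalar_field R k]_n) :
  `|dotF x y| ^+ 2 <= dotF x x * dotF y y.
Proof.
have [x0|x0] := eqVneq (dotF x x) 0.
  by rewrite (dotF_eq0 x0) /dotF trmx0 map_mx0 !mul0mx mxE normr0 expr0n mul0r.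
have xp : 0 < dotF x x by rewrite lt_def x0 dotF_ge0.
have := dotF_ge0 (dotF x x *: y - dotF x y *: x).
rewrite -scaleNr dotFDl !dotFDr !dotFZl !dotFZr rmorphN /=.
rewrite (conjF_ge0 (dotF_ge0 x)) (dotFC x y) -mulJ_norm.
set a := dotF x x; set b := dotF x y; set d := dotF y y; set b' := conjF b.
have -> : a * (a * d) + a * (- b * b') + (- b' * (a * b) + - b' * (- b * a)) =
    a * (a * d - b' * b) by ring.
by rewrite pmulr_rge0 // subr_ge0.
Qed.

(** With P = S^* S the form is |S x|^2; Cauchy-Schwarz applied to each entry of S x leaves the sum
    of the squared column norms of [S], which is the trace of [P]. *)
Lemma dotF_psd_le k n (P : 'M[scalar_field R k]_n) x :
  psdmx P -> dotF x (P *m x) <= \tr P * dotF x x.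
Proof.
move=> /psdmx_factor[S Sp ->].
have -> : \tr (S^*t *m S) = \sum_j dotF (col j S) (col j S).
  have := mxtrace_psd 1%:M S; rewrite mulmx1 => ->.
  by apply: eq_bigr => j _; rewrite mul1mx.
rewrite -mulmxA -dotF_adj [leLHS]dotFE mulr_suml; apply: ler_sum => i _.
have -> : (S *m x) i 0 = dotF (col i S) x.
  by rewrite -[in LHS]Sp.1 /dotF tr_col map_row -row_mul [RHS]mxE.
exact: dotF_CS.
Qed.

End PsdInequalities.

(** * Gram matrices and their rows *)

Section Gram.
Context {R : realType} {k : RorC} {H : hilbertType R k}.
Local Notation F := (scalar_field R k).

Lemma gram_sum_rows m n (A : 'M[H]_(m, n)) : gram A = \sum_i gram (row i A).
Proof.
apply/matrixP => j l; rewrite gramE summxE.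
by apply: eq_bigr => i _; rewrite [RHS]gramE big_ord1 !mxE.
Qed.

Lemma gram_rows m n (A : 'M[H]_(m, n)) (I : {set 'I_m}) :
  gram (rows A I) = \sum_(i in I) gram (row i A).
Proof.
rewrite gram_sum_rows [RHS]big_enum_val; apply: eq_bigr => i _; congr gram.
by apply/rowP => j; rewrite !mxE.
Qed.

Lemma gram_col_mx m1 m2 n (A : 'M[H]_(m1, n)) (B : 'M[H]_(m2, n)) :
  gram (col_mx A B) = gram A + gram B.
Proof.
apply/matrixP => j l; rewrite [RHS]mxE !gramE big_split_ord /=.
by congr (_ + _); apply: eq_bigr => i _; rewrite ?col_mxEu ?col_mxEd.
Qed.

Lemma reF_det_gram_ge0 m n (A : 'M[H]_(m, n)) : 0 <= reF (\det (gram A)).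
Proof. exact/reF_ge0/det_psd_ge0/psdmx_gram. Qed.

(** * Whitening by W = G^(-1/2), where G = [gram A] *)

Section Whitening.
Context {m n : nat} (A : 'M[H]_(m, n)).
Hypothesis A0 : gram A \in unitmx.
Let S := sqrtmx (gram A).
Let W := invmx S.

Lemma sqrt_gram_unit : S \in unitmx.
Proof.
have [_ SS] := sqrtmxP (psdmx_gram A).
by move: A0; rewrite -SS unitmx_mul => /andP[].
Qed.

Lemma whiten_herm : W^*t = W.
Proof.
by rewrite /W trmx_inv map_invmx (sqrtmxP (psdmx_gram A)).1.1.
Qed.

Lemma whiten_gram : W *m gram A *m W = 1%:M.
Proof.
rewrite -(sqrtmxP (psdmx_gram A)).2 -/S mulmxA mulVmx ?sqrt_gram_unit //.
by rewrite mul1mx mulmxV ?sqrt_gram_unit.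
Qed.

Lemma det_whiten (M : 'M[F]_n) :
  reF (\det (W *m M *m W)) = reF (\det M) / reF (\det (gram A)).
Proof.
have d0 : 0 <= \det (gram A) by exact/det_psd_ge0/psdmx_gram.
have du : \det (gram A) != 0 by rewrite -unitfE -unitmxE.
have WGW : \det W * \det (gram A) * \det W = 1.
  by have := congr1 determinant whiten_gram; rewrite !det_mulmx det1.
have dM : \det (gram A) * \det (W *m M *m W) = \det M.
  by rewrite -[RHS]mul1r -WGW !det_mulmx; ring.
have rd : reF (\det (gram A)) != 0.
  apply/eqP => r0; have := congr1 reF WGW.
  rewrite mulrAC mulrC reFM // r0 mul0r => /esym/eqP.
  by rewrite (reF_nat 1) oner_eq0.
by rewrite -dM reFM // mulrAC mulfV // mul1r.
Qed.

(** Since W G W = 1, the whitened row Gram matrices have traces adding up to n, and each det (1 -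
    S_i) is det (G - G_i) / det G. *)
Lemma excessE :
  excess A = \sum_i reF (\det (gram A - gram (row i A))) / reF (\det (gram A))
    - m%:R + n%:R.
Proof.
have trS : \sum_i reF (\tr (W *m gram (row i A) *m W)) = n%:R :> R.
  rewrite -raddf_sum -raddf_sum -mulmx_suml -mulmx_sumr -gram_sum_rows.
  by rewrite whiten_gram /= mxtrace_scalar reF_nat.
have mE : m%:R = \sum_(i < m) 1 :> R by rewrite sumr_const card_ord.
rewrite -[in RHS]trS mE -sumrB -big_split /=.
apply: eq_bigr => i _; rewrite /excess_at -/S -/W -whiten_gram.
rewrite -mulmxBl -mulmxBr det_whiten /=.
by rewrite opprB addrA addrAC.
Qed.

Lemma psdmx_whiten P : psdmx P -> psdmx (W *m P *m W).
Proof. by move/(psdmx_conj W); rewrite whiten_herm. Qed.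

Lemma det_gramD_ge P : psdmx P ->
  1 + reF (\tr (W *m P *m W)) <= reF (\det (gram A + P)) / reF (\det (gram A)).
Proof.
move=> /psdmx_whiten/det_1D_psd/reF_le; rewrite raddfD /= (reF_nat 1).
by rewrite -det_whiten mulmxDr mulmxDl whiten_gram.
Qed.

(** Substituting x = W (S x) turns the claim into the trace bound for W P W at S x, because |S x|^2
    = <x, G x>. *)
Lemma dotF_whiten_le P x : psdmx P ->
  dotF x (P *m x) <= \tr (W *m P *m W) * dotF x (gram A *m x).
Proof.
move=> Pp; have [[Sh _] SS] := sqrtmxP (psdmx_gram A).
have xE : x = W *m (S *m x) by rewrite mulKmx ?sqrt_gram_unit.
have -> : dotF x (gram A *m x) = dotF (S *m x) (S *m x).
  by rewrite dotF_adj Sh mulmxA SS.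
rewrite {1 2}xE (dotF_adj W) whiten_herm (mulmxA W P) (mulmxA (W *m P)).
exact/dotF_psd_le/psdmx_whiten.
Qed.

End Whitening.

(** * The pseudoinverse on the unit ball *)

Lemma dotH_ge0 m (x : (H ^ m)%type) : 0 <= dotH x x.
Proof. by rewrite sumr_ge0 // => i _; rewrite inner_norm exprn_ge0. Qed.

Lemma mpinv_dotF_gram m n (A : 'M[H]_(m, n)) y : l2H y <= 1 ->
  reF (dotF (mpinv A y) (gram A *m mpinv A y)) <= 1.
Proof.
have [_ _ XAX AXh _] := mpinvP A.
rewrite -badj_bapp -bapp_adj -[X in _ <= X -> _]sqrtr1 ler_sqrt // => y1.
set z := bapp A (mpinv A y).
(* [z] is the orthogonal projection of [y] onto the range of [A], so |y|^2 - |z|^2 = |y - z|^2. *)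
have zy : dotH z y = dotH z z by rewrite /z -[in RHS]AXh XAX.
have yz : dotH y z = dotH z z by rewrite dotHC zy -dotHC.
apply: le_trans y1; apply: reF_le; rewrite -subr_ge0.
have := dotH_ge0 (y - z).
by rewrite dotHB [dotH y _]dotHC [dotH z _]dotHC !dotHB !rmorphB /= -!dotHC
  yz zy subrr subr0.
Qed.

End Gram.

(** * Consequences of maximal volume *)

Section MaxVolume.
Context {R : realType} {k : RorC} {H : hilbertType R k}.
Context {m n : nat} (U : 'M[H]_(m, n)) (I : {set 'I_m}).
Hypothesis volI : forall J : {set 'I_m}, #|J| = #|I| ->
  volume (rows U J) <= volume (rows U I).
Hypothesis volI_gt0 : 0 < volume (rows U I).
Let A := rows U I.
Let W := invmx (sqrtmx (gram A)).

Lemma max_det_gt0 : 0 < reF (\det (gram A)).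
Proof. by rewrite -sqrtr_gt0. Qed.

Lemma max_gram_unit : gram A \in unitmx.
Proof. by rewrite unitmxE unitfE reF_neq0 // max_det_gt0. Qed.

Lemma max_det (J : {set 'I_m}) : #|J| = #|I| ->
  reF (\det (gram (rows U J))) <= reF (\det (gram A)).
Proof. by move=> /volI; rewrite ler_sqrt ?reF_det_gram_ge0. Qed.

(** Deleting any row of [A; u_i] leaves the rows of a set of size |I|, to which maximality applies:
    either a row of I is exchanged for i, or the appended row goes and I itself remains. *)
Lemma gram_exchange i (j : 'I_(#|I| + 1)) : i \notin I ->
  let B := col_mx A (row i U) in
  exists2 J : {set 'I_m}, #|J| = #|I| & gram B - gram (row j B) = gram (rows U J).
Proof.
move=> iI B; rewrite /B gram_col_mx; case: (split_ordP j) => l ->.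
  have aI := enum_valP l; set a := enum_val l in aI.
  have iIa : i \notin I :\ a by rewrite inE (negPf iI) andbF.
  exists (i |: I :\ a); first by rewrite cardsU1 iIa [RHS](cardsD1 a) aI.
  have -> : row (lshift 1 l) (col_mx A (row i U)) = row a U.
    by rewrite rowKu; apply/rowP => c; rewrite !mxE.
  rewrite !gram_rows big_setU1 //= (big_setD1 a aI) /= addrAC.
  by rewrite (addrC (gram (row a U))) addrK addrC.
exists I => //; rewrite (_ : row _ _ = row i U) ?addrK //.
by rewrite rowKd; apply/rowP => c; rewrite !mxE.
Qed.

Lemma tr_whiten_excess i : i \notin I ->
  reF (\tr (W *m gram (row i U) *m W)) <=
    (n%:R - excess (col_mx A (row i U))) /
    (#|I|%:R + 1 - n%:R + excess (col_mx A (row i U))).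
Proof.
move=> iI; set B := col_mx A (row i U); set e := excess B.
have g0 := max_det_gt0; set g := reF _ in g0.
have GB : gram B = gram A + gram (row i U) by rewrite gram_col_mx.
have trge := det_gramD_ge max_gram_unit (psdmx_gram (row i U)).
rewrite -GB -/W in trge; set t := reF (\tr _) in trge *.
rewrite -/g in trge; set d := reF (\det (gram B)) in trge.
have t0 : 0 <= t.
  exact/reF_ge0/mxtrace_psd_ge0/psdmx_whiten/psdmx_gram.
have d0 : 0 < d.
  have : 0 < d / g by apply: lt_le_trans trge; rewrite ltr_pwDl.
  by rewrite pmulr_lgt0 // invr_gt0.
have Bu : gram B \in unitmx by rewrite unitmxE unitfE reF_neq0.
pose D := \sum_j reF (\det (gram B - gram (row j B))) / d.
have eE : e = D - (#|I| + 1)%:R + n%:R by exact: excessE.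
(* The term of [D] that deletes the appended row is exactly g / d, and the others are nonnegative;
   this makes [D] positive. *)
have Dg : g / d <= D.
  have dropE : gram B - gram (row (rshift #|I| ord0) B) = gram A.
    rewrite rowKd GB (_ : row _ _ = row i U) ?addrK //.
    by apply/rowP => c; rewrite !mxE.
  rewrite /D (bigD1 (rshift #|I| ord0)) //= dropE lerDl sumr_ge0 // => j _.
  have [J _ ->] := gram_exchange j iI.
  by rewrite divr_ge0 ?reF_det_gram_ge0 ?ltW.
(* By maximality each of the |I| + 1 determinants is at most [g]. *)
have Dle : D <= (#|I| + 1)%:R * (g / d).
  rewrite mulr_natl -[X in _ *+ X]card_ord -sumr_const ler_sum // => j _.
  have [J JI ->] := gram_exchange j iI.
  by rewrite ler_pM2r ?invr_gt0 // max_det.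
have -> : n%:R - e = (#|I| + 1)%:R - D by rewrite eE; ring.
have -> : #|I|%:R + 1 - n%:R + e = D by rewrite eE natrD; ring.
have D0 : 0 < D by apply: lt_le_trans Dg; rewrite divr_gt0.
(* The goal t <= (N - D) / D becomes (1 + t) D <= N, with N = |I| + 1; the bounds 1 + t <= d / g and
   D <= N g / d then multiply to it. *)
rewrite ler_pdivlMr // lerBrDl -[X in X + _]mul1r -mulrDl.
apply: le_trans (ler_pM _ (ltW D0) trge Dle) _; first by rewrite addr_ge0.
by rewrite mulrCA -(invf_div d) divff ?mulr1 // gt_eqF // divr_gt0.
Qed.

End MaxVolume.

(** * The operator norm bound *)

Theorem theorem7p8 (R : realType) (k : RorC) (H : hilbertType R k)
    (m kappa : nat) (U : 'M[H]_(m, kappa)) (I : {set 'I_m}) :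
  orthonormal_columns U ->
  (forall J : {set 'I_m}, #|J| = #|I| ->
    volume (rows U J) <= volume (rows U I)) ->
  0 < volume (rows U I) ->
  let Rt (i : 'I_m) := col_mx (rows U I) (row i U) in
  (opnorm (mpinv (rows U I)) <=
    (Num.sqrt (1 + \sum_(i | i \notin I)
       (kappa%:R - excess (Rt i)) / (#|I|%:R + 1 - kappa%:R + excess (Rt i))))%:E)%E.
Proof.
move=> Uo volI vol0 /=; apply: ge_ereal_sup => _ [y y1 <-].
rewrite lee_fin; apply: ler_wsqrtr.
set A := rows U I; set x := mpinv A y; set s := dotF x (gram A *m x).
have s0 : 0 <= s by exact: (psdmx_gram A).2.
have s1 : reF s <= 1 by exact: mpinv_dotF_gram.
pose W := invmx (sqrtmx (gram A)).
have Au : gram A \in unitmx := max_gram_unit vol0.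
(* Orthonormality writes the identity as the sum of all row Gram matrices; the rows in I contribute
   [s]. *)
have -> : dotF x x = s + \sum_(i | i \notin I) dotF x (gram (row i U) *m x).
  rewrite -[X in dotF _ X]mul1mx -Uo gram_sum_rows (bigID (mem I)) /=.
  rewrite -gram_rows.
  by rewrite mulmxDl dotFDr mulmx_suml /dotF mulmx_sumr summxE.
apply: (@le_trans _ _ (reF (s +
    \sum_(i | i \notin I) \tr (W *m gram (row i U) *m W) * s))).
  apply/reF_le; rewrite lerD2l ler_sum // => i _.
  exact/dotF_whiten_le/psdmx_gram.
(* The bound s <= 1 serves twice: for the leading 1 and inside each summand. *)
rewrite raddfD raddf_sum /= lerD // ler_sum // => i iI.
have p0 : 0 <= \tr (W *m gram (row i U) *m W).
  exact/mxtrace_psd_ge0/psdmx_whiten/psdmx_gram.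
rewrite reFM //; apply: le_trans (tr_whiten_excess volI vol0 iI).
by rewrite ler_piMr ?reF_ge0.
Qed.
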